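(* Let $N$ be a normal subgroup of a finite group $G$, and let $\mathbb{K}$ be a field. Let $\{K_1,\dots,K_l\}$ be the set of $G$-conjugacy classes of $N$, and let $\widehat{K_i}=\sum_{x\in K_i}x$ be the formal sum of $K_i$ in $\mathbb{K}[G]$, for each $i=1,\dots,l$. Then $\{\widehat{K_1},\dots,\widehat{K_l}\}$ forms a basis of the $\mathbb{K}$-algebra $\mathbf{Z}(\mathbb{K}[G])\cap\mathbb{K}[N]$.
   Context: The $G$-conjugacy classes of $N$ are the conjugacy classes $x^G=\{x^g\mid g\in G\}$ of $G$ with $x\in N$. $\mathbf{Z}(\mathbb{K}[G])$ is the center of the group algebra $\mathbb{K}[G]$, and $\mathbb{K}[N]$ is viewed as a subalgebra of $\mathbb{K}[G]$. *)

(* Defs.v *)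
From HB Require Import structures.
From mathcomp Require Import all_boot all_order all_algebra all_fingroup all_field.

Set Implicit Arguments.
Unset Strict Implicit.
Unset Printing Implicit Defensive.

Import GRing.Theory.
Local Open Scope ring_scope.

(* The group algebra is carried by the coefficient functions gT -> K, with the *)
(* pointwise vector space structure; only that structure is copied, because    *)
(* the library's own product on {ffun gT -> K} is pointwise, not convolution.  *)
Definition group_algebra (K : fieldType) (gT : finGroupType) : Type :=
  {ffun gT -> K^o}.

HB.instance Definition _ (K : fieldType) (gT : finGroupType) :=
  Vector.copy (group_algebra K gT) {ffun gT -> K^o}.

Section GroupAlgebra.

Variables (K : fieldType) (gT : finGroupType).
Local Notation KG := (group_algebra K gT).
Implicit Types (a b c : KG) (x y z : gT) (A B : {set gT}) (G N : {group gT}).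

Definition gcoef a x : K := (a : {ffun gT -> K^o}) x.

Definition ga_make (f : gT -> K) : KG := [ffun x => f x : K^o].

Lemma ga_makeE f x : gcoef (ga_make f) x = f x.
Proof. by rewrite /gcoef ffunE. Qed.

Lemma gcoefP a b : (forall x, gcoef a x = gcoef b x) -> a = b.
Proof. by move=> eq_ab; apply/ffunP=> x; apply: eq_ab. Qed.

Lemma gcoefD a b x : gcoef (a + b) x = gcoef a x + gcoef b x.
Proof. by rewrite /gcoef ffunE. Qed.

Lemma gcoefZ (k : K) a x : gcoef (k *: a) x = k * gcoef a x.
Proof. by rewrite /gcoef ffunE. Qed.

Lemma gcoef0 x : gcoef 0 x = 0.
Proof. by rewrite /gcoef ffunE. Qed.

Lemma gcoef_sum I (r : seq I) (P : pred I) (F : I -> KG) x :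
  gcoef (\sum_(i <- r | P i) F i) x = \sum_(i <- r | P i) gcoef (F i) x.
Proof.
by apply: (big_morph (gcoef^~ x)) => [a b|]; rewrite ?gcoefD ?gcoef0.
Qed.

Definition gelt x : KG := ga_make (fun y => (y == x)%:R).

Definition ga_mul a b : KG :=
  ga_make (fun z => \sum_x gcoef a x * gcoef b (x^-1 * z)%g).

Fact ga_mulA : associative ga_mul.
Proof.
move=> a b c; apply: gcoefP => z; rewrite !ga_makeE.
under eq_bigr => x _ do rewrite ga_makeE mulr_sumr.
under [RHS]eq_bigr => x _ do rewrite ga_makeE mulr_suml.
rewrite [RHS]exchange_big /=; apply: eq_bigr => x _.
rewrite [RHS](reindex_inj (mulgI x)) /=; apply: eq_bigr => y _.
by rewrite invMg !mulgA mulVg mul1g mulrA.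
Qed.

Fact ga_mul1l : left_id (gelt 1%g) ga_mul.
Proof.
move=> a; apply: gcoefP => z; rewrite ga_makeE (bigD1 1%g) //= big1 => [|x].
  by rewrite ga_makeE eqxx mul1r invg1 mul1g addr0.
by move=> /negPf x1; rewrite ga_makeE x1 mul0r.
Qed.

Fact ga_mul1r : right_id (gelt 1%g) ga_mul.
Proof.
move=> a; apply: gcoefP => z; rewrite ga_makeE (bigD1 z) //= big1 => [|x].
  by rewrite ga_makeE mulVg eqxx mulr1 addr0.
by move=> /negPf xz; rewrite ga_makeE -eq_mulVg1 xz mulr0.
Qed.

Fact ga_mulDl : left_distributive ga_mul +%R.
Proof.
move=> a b c; apply: gcoefP => z; rewrite gcoefD !ga_makeE -big_split /=.
by apply: eq_bigr => x _; rewrite gcoefD mulrDl.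
Qed.

Fact ga_mulDr : right_distributive ga_mul +%R.
Proof.
move=> a b c; apply: gcoefP => z; rewrite gcoefD !ga_makeE -big_split /=.
by apply: eq_bigr => x _; rewrite gcoefD mulrDr.
Qed.

Fact ga_one_neq0 : gelt 1%g != 0.
Proof.
apply/eqP => /(congr1 (gcoef^~ 1%g)); rewrite ga_makeE gcoef0 eqxx.
by move/eqP; rewrite oner_eq0.
Qed.

HB.instance Definition _ := GRing.Zmodule_isNzRing.Build KG
  ga_mulA ga_mul1l ga_mul1r ga_mulDl ga_mulDr ga_one_neq0.

Lemma gcoefM a b z :
  gcoef (a * b) z = \sum_x gcoef a x * gcoef b (x^-1 * z)%g.
Proof. exact: ga_makeE. Qed.

Fact ga_scalerAl (k : K) a b : k *: (a * b) = k *: a * b.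
Proof.
apply: gcoefP => z; rewrite gcoefZ !gcoefM mulr_sumr.
by apply: eq_bigr => x _; rewrite gcoefZ mulrA.
Qed.

Fact ga_scalerAr (k : K) a b : k *: (a * b) = a * (k *: b).
Proof.
apply: gcoefP => z; rewrite gcoefZ !gcoefM mulr_sumr.
by apply: eq_bigr => x _; rewrite gcoefZ mulrCA.
Qed.

HB.instance Definition _ :=
  GRing.Lmodule_isLalgebra.Build K KG ga_scalerAl.
HB.instance Definition _ :=
  GRing.Lalgebra_isAlgebra.Build K KG ga_scalerAr.
HB.instance Definition _ := Algebra_isFalgebra.Build K KG.

Lemma gelt1 : gelt 1%g = 1.
Proof. by []. Qed.

Lemma geltM x y : gelt (x * y)%g = gelt x * gelt y.
Proof.
apply: gcoefP => z; rewrite gcoefM (bigD1 x) //= big1 => [|t /negPf tx].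
  by rewrite !ga_makeE eqxx mul1r addr0 -[in RHS](inj_eq (mulgI x)) mulKVg.
by rewrite ga_makeE tx mul0r.
Qed.

(* K[A] inside K[gT]; for a group A this is the group algebra of A, and        *)
(* K[N] <= K[G] whenever N \subset G.                                          *)
Definition galg A : {vspace KG} := <<[seq gelt x | x in A]>>%VS.

Definition gsum A : KG := \sum_(x in A) gelt x.

Lemma gelt_galg A x : x \in A -> gelt x \in galg A.
Proof. by move=> Ax; apply/memv_span/image_f. Qed.

Lemma gaE a : a = \sum_x gcoef a x *: gelt x.
Proof.
apply: gcoefP => z; rewrite gcoef_sum (bigD1 z) //= big1 => [|x].
  by rewrite gcoefZ ga_makeE eqxx mulr1 addr0.
by rewrite eq_sym => /negPf xz; rewrite gcoefZ ga_makeE xz mulr0.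
Qed.

Lemma galgP A a :
  reflect (forall x, x \notin A -> gcoef a x = 0) (a \in galg A).
Proof.
apply: (iffP idP) => [/coord_span-> x notAx | supp_a].
  rewrite gcoef_sum big1 // => i _; rewrite gcoefZ.
  have /imageP[y Ay ->] : (image_tuple gelt A)`_i \in image gelt A.
    by apply: mem_nth; rewrite size_tuple.
  rewrite ga_makeE; case: eqP => [xy | _]; last by rewrite mulr0.
  by rewrite xy Ay in notAx.
rewrite [a]gaE memv_suml // => x _.
case: (boolP (x \in A)) => [/gelt_galg | /supp_a->]; first exact: memvZ.
by rewrite scale0r mem0v.
Qed.

Lemma galgT : galg [set: gT] = fullv.
Proof. by apply/vspaceP=> a; rewrite memvf; apply/galgP=> x; rewrite inE. Qed.

Fact galg_is_aspace G : is_aspace (galg G).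
Proof.
rewrite /is_aspace has_algid1 /=; last by rewrite -gelt1 gelt_galg.
apply/prodvP=> a b /galgP Ga /galgP Gb; apply/galgP=> z notGz.
rewrite gcoefM big1 // => x _; case: (boolP (x \in G)) => [Gx | /Ga->].
  by rewrite Gb ?mulr0 // groupMl ?groupV.
by rewrite mul0r.
Qed.
Canonical galg_aspace G := ASpace (galg_is_aspace G).

Fact center_cap_galg_is_aspace G N : is_aspace ('Z(galg G) :&: galg N)%VS.
Proof.
have gal1 H : 1 \in galg (H : {group gT}) by rewrite -gelt1 gelt_galg.
rewrite /is_aspace has_algid1 /=; last first.
  rewrite !memv_cap !gal1 !andbT /=.
  by apply/centvP=> a _; rewrite mulr1 mul1r.
apply/prodvP=> a b; rewrite !memv_cap => /andP[/andP[Ga Ca] Na].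
by move=> /andP[/andP[Gb Cb] Nb]; rewrite !memvM.
Qed.
Canonical center_cap_galg_aspace G N := ASpace (center_cap_galg_is_aspace G N).

End GroupAlgebra.

Arguments gelt K {gT} x.
Arguments galg K {gT} A%_g.
Arguments gsum K {gT} A%_g.

(* Main.v *)
(* Comparing coefficients of g * a and a * g for g in G shows that a commutes  *)
(* with K[G] iff its coefficients are constant on G-classes. Such an a         *)
(* supported in N is the combination of the class sums of N whose coefficient  *)
(* at C is the common value of a on C; freeness holds because distinct classes *)
(* have disjoint nonempty supports.                                            *)
Require Import Defs.
From mathcomp Require Import all_boot all_order all_algebra all_fingroup all_field.

Section ClassSums.

Set Implicit Arguments.
Unset Strict Implicit.

Import GRing.Theory.
Local Open Scope ring_scope.

Variables (K : fieldType) (gT : finGroupType).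
Implicit Types (a : group_algebra K gT) (x y z : gT).
Implicit Types (A C : {set gT}) (P : {set {set gT}}) (G N : {group gT}).

(** Everything is read off coefficients: [gsum K A] is the indicator function of [A], and membership
    in the center means invariance under conjugation ([cent_galgP]). Normality of [N] places each
    class of an element of [N] inside [N], so its sum lies in the intersection
    ([gsum_center_cap_galg]). Conversely [center_cap_galg_sum] expands any element of the
    intersection in class sums, and [free_gsum] gives independence. *)

Lemma gcoef_gsum A x : gcoef (gsum K A) x = (x \in A)%:R.
Proof.
rewrite gcoef_sum; under eq_bigr do rewrite ga_makeE.
case: (boolP (x \in A)) => [Ax | notAx].
  rewrite (bigD1 x) //= eqxx big1 ?addr0 // => y /andP[_ /negPf yx].
  by rewrite eq_sym yx.
rewrite big1 // => y Ay; case: eqP => // xy.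
by rewrite xy Ay in notAx.
Qed.

Lemma gcoef_gelt_mul y a z : gcoef (gelt K y * a) z = gcoef a (y^-1 * z)%g.
Proof.
rewrite gcoefM (bigD1 y) //= big1 => [|x /negPf xy].
  by rewrite ga_makeE eqxx mul1r addr0.
by rewrite ga_makeE xy mul0r.
Qed.

Lemma gcoef_mul_gelt a y z : gcoef (a * gelt K y) z = gcoef a (z * y^-1)%g.
Proof.
rewrite gcoefM (bigD1 (z * y^-1)%g) //= big1 => [|x xzy].
  by rewrite ga_makeE invMg invgK mulgKV eqxx mulr1 addr0.
rewrite ga_makeE; case: eqP => [xy|]; last by rewrite mulr0.
by rewrite -xy invMg invgK mulKVg eqxx in xzy.
Qed.

(** By linearity it suffices to commute with each [gelt K y], [y] in [A]. At [x * y], the two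
    products have coefficients [gcoef a (x ^ y)] and [gcoef a x]. *)
Lemma cent_galgP A a :
  reflect (forall x y, y \in A -> gcoef a (x ^ y)%g = gcoef a x)
          (a \in 'C(galg K A)%VS).
Proof.
apply: (iffP centvP) => [Ca x y Ay | class_a b].
  have := congr1 (fun b => gcoef b (x * y)%g) (Ca _ (gelt_galg K Ay)).
  by rewrite gcoef_gelt_mul gcoef_mul_gelt mulgK conjgE.
move/galgP=> Ab; rewrite [b]gaE mulr_sumr mulr_suml; apply: eq_bigr => y _.
case: (boolP (y \in A)) => [Ay | /Ab->]; last by rewrite scale0r mulr0 mul0r.
rewrite -scalerAr -scalerAl; congr (_ *: _); apply: gcoefP => z.
by rewrite gcoef_gelt_mul gcoef_mul_gelt -(class_a _ _ Ay) conjgE mulgKV.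
Qed.

(** Evaluating a vanishing combination at a point of a block leaves only the scalar of that
    block. *)
Lemma free_gsum P :
  trivIset P -> set0 \notin P -> free [seq gsum K C | C <- enum P].
Proof.
move=> tiP notP0; rewrite -[map _ _]/(tval (map_tuple _ (enum_tuple P))).
apply/freeP=> k sum0 i; pose C := tnth (enum_tuple P) i.
have PC j : tnth (enum_tuple P) j \in P by rewrite -mem_enum mem_tnth.
have /set0Pn[x Cx] : C != set0 by apply: contraNneq notP0 => <-; apply: PC.
have := congr1 (fun b => gcoef b x) sum0.
rewrite gcoef_sum gcoef0 (bigD1 i) //= big1 => [|j ji].
  rewrite gcoefZ -[_`_i](tnth_nth 0 (map_tuple _ _)) tnth_map gcoef_gsum.
  by rewrite Cx mulr1 addr0.
rewrite gcoefZ -[_`_j](tnth_nth 0 (map_tuple _ _)) tnth_map gcoef_gsum.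
case: (boolP (x \in _)) => [Dx | _]; last by rewrite mulr0.
(* Both sets contain [x], so each is the block of [x] in [P]; as [enum P] has no repeats, the
   indices agree. *)
case/eqP: ji; apply: (tuple_uniqP _ (enum_uniq P)).
by rewrite -(def_pblock tiP (PC j) Dx) (def_pblock tiP (PC i) Cx).
Qed.

Lemma trivIset_classes A G : trivIset [set (x ^: G)%g | x in A].
Proof.
apply/trivIsetP=> _ _ /imsetP[x _ ->] /imsetP[y _ ->].
apply: contraR => /pred0Pn[z /andP[/= /class_eqP <- /class_eqP <-]].
exact: eqxx.
Qed.

Lemma gsum_center_cap_galg G N x :
  (N <| G)%g -> x \in N -> gsum K (x ^: G)%g \in ('Z(galg K G) :&: galg K N)%VS.
Proof.
case/andP=> sNG nNG Nx; rewrite !memv_cap -andbA.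
have sxN : (x ^: G)%g \subset N by rewrite class_sub_norm.
have supp A : (x ^: G)%g \subset A -> gsum K (x ^: G)%g \in galg K A.
  by move=> sxA; apply: memv_suml => y xy; apply/gelt_galg/(subsetP sxA).
rewrite !supp ?(subset_trans sxN) // andbT /=.
(* The indicator of a class is invariant because [G] normalizes the class. *)
apply/cent_galgP => y g Gg.
by rewrite !gcoef_gsum memJ_norm // (subsetP (class_norm x G)).
Qed.

(** The choice made by [repr] is harmless, since [a] is constant on each class. *)
Lemma center_cap_galg_sum G N a :
    (N <| G)%g -> a \in ('Z(galg K G) :&: galg K N)%VS ->
  a = \sum_(C in [set (x ^: G)%g | x in N]) gcoef a (repr C) *: gsum K C.
Proof.
case/andP=> sNG nNG; rewrite !memv_cap -andbA.
case/and3P=> _ /cent_galgP class_a /galgP supp_a.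
apply: gcoefP => z; rewrite gcoef_sum.
under eq_bigr do rewrite gcoefZ gcoef_gsum.
case: (boolP (z \in N)) => [Nz | notNz].
  rewrite (bigD1 (z ^: G)%g) /=; last exact: imset_f.
  rewrite class_refl mulr1 big1 ?addr0.
    by case/imsetP: (mem_repr z (class_refl G z)) => g Gg ->; rewrite class_a.
  move=> _ /andP[/imsetP[x _ ->] xz]; case: (boolP (z \in _)) => [|_].
    by move/class_eqP=> zx; rewrite zx eqxx in xz.
  by rewrite mulr0.
(* Outside [N] both sides vanish: every class in the sum stays inside [N]. *)
rewrite supp_a // big1 // => _ /imsetP[x Nx ->].
case: (boolP (z \in _)) => [xz | _]; last by rewrite mulr0.
have /subsetP/(_ z xz) : (x ^: G)%g \subset N by rewrite class_sub_norm.
by rewrite (negPf notNz).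
Qed.

End ClassSums.

Theorem lemma3p1 (K : fieldType) (gT : finGroupType) (G N : {group gT})
    (nNG : (N <| G)%g) :
  basis_of ('Z(galg K G) :&: galg K N)%VS
    [seq gsum K C | C <- enum [set (x ^: G)%g | x in N]].
Proof.
apply/andP; split; last first.
  apply: free_gsum; first exact: trivIset_classes.
  by apply/imsetP=> -[x _ x0]; have := class_refl G x; rewrite -x0 inE.
rewrite eqEsubv; apply/andP; split.
  apply/span_subvP => _ /mapP[C PC ->]; rewrite mem_enum in PC.
  case/imsetP: PC => x Nx ->.
  exact: gsum_center_cap_galg.
apply/subvP=> a /(center_cap_galg_sum nNG)->; apply: memv_suml => C NC.
by apply/memvZ/memv_span/map_f; rewrite mem_enum.
Qed.
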